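(* Let $m\ge1$, $r\ge0$ be integers, let $P\in LPDO_r$ and write its total symbol as $\lambda_P=\sum_{|\alpha|\le r}f_\alpha y_\alpha$. Suppose that $\sum_{|\alpha|\le r}|f_\alpha(x)|\ne0$ for all $x\in\mathbb R^m$. Then for all $g\in{}^*C^\infty(\mathbb R^m,\mathbb R)$, the pair $({}^*\lambda_P,g)$ satisfies ${}^\sigma PCP$.
   Context: ${}^*$ denotes a fixed (polysaturated) superstructure nonstandard extension; ${}^*C^\infty(\mathbb R^m,\mathbb R)$ is the set of internal *smooth functions ${}^*\mathbb R^m\to{}^*\mathbb R$. $\mathcal J^r_{m,1}$ is the bundle over $\mathbb R^m$ of $r$-jets $j^r_xf$ of functions $f\in C^\infty(\mathbb R^m,\mathbb R)$, with projection $\pi^r:\mathcal J^r_{m,1}\to\mathbb R^m$ and global coordinates $(x_i,y_\alpha)_{1\le i\le m,|\alpha|\le r}$, $y_\alpha(j^r_xf)=\partial^\alpha f(x)$. $LPDO_r$ is the space of linear partial differential operators $P=\sum_{|\alpha|\le r}f_\alpha\partial^\alpha$ with $f_\alpha\in C^\infty(\mathbb R^m,\mathbb R)$; the total symbol is the function $\lambda_P=\sum_{|\alpha|\le r}f_\alpha y_\alpha$ on $\mathcal J^r_{m,1}$, so $P(f)(x)=\lambda_P(j^r_xf)$. ${}^\sigma PCP$ (pointwise covering property): for $\Lambda\in{}^*C^\infty(\mathcal J^r_{m,1},\mathbb R)$ and $g\in{}^*C^\infty(\mathbb R^m,\mathbb R)$, the pair $(\Lambda,g)$ satisfies ${}^\sigma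 PCP$ if for every $x\in\mathbb R^m$ there is $p\in({}^*\pi^r)^{-1}({}^*x)\subset{}^*\mathcal J^r_{m,1}$ with $\Lambda(p)=g({}^*x)$. *)

(* Defs.v *)
From HB Require Import structures.
From mathcomp Require Import all_boot all_order all_algebra.
From mathcomp Require Import all_classical all_reals all_analysis.

Set Implicit Arguments.
Unset Strict Implicit.
Unset Printing Implicit Defensive.

Import Order.TTheory GRing.Theory Num.Theory.
Import numFieldNormedType.Exports.

Local Open Scope classical_set_scope.
Local Open Scope ring_scope.

(** * Superstructures and nonstandard extensions *)

(* With V_0 = X and V_(n+1) = V_n `|` P(V_n), this is V_n, as a subset of a
   universe [U] with membership [elem] whose urelements are [range atom]. *)
Fixpoint level (X U : Type) (elem : U -> U -> Prop) (atom : X -> U) (n : nat) :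
    set U :=
  if n is k.+1 then
    level elem atom k `|`
    [set a | ~ range atom a /\ forall c, elem c a -> level elem atom k c]
  else range atom.

(* The superstructure V(X) = \bigcup_n V_n over a set X of urelements, given by
   axioms that characterize it up to isomorphism.  [setof A] is the set with
   elements A when A is included in some V_n; it is unspecified otherwise. *)
Record superstructure (X : Type) := Superstructure {
  univ :> Type;
  elem : univ -> univ -> Prop;
  atom : X -> univ;
  setof : set univ -> univ;
  atom_inj : injective atom;
  elem_atom : forall a x, ~ elem a (atom x);
  elem_ext : forall a b, ~ range atom a -> ~ range atom b ->
    (forall c, elem c a <-> elem c b) -> a = b;
  level_cover : forall a, exists n, level elem atom n a;
  setof_set : forall n A, A `<=` level elem atom n -> ~ range atom (setof A);
  elem_setof : forall n A, A `<=` level elem atom n ->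
    forall c, elem c (setof A) <-> A c }.

Arguments elem {X s}.
Arguments atom {X s}.
Arguments setof {X s}.

(* Formulas of the language of set theory with bounded quantifiers only.
   Variables are de Bruijn indices: in [BAll i p] and [BEx i p] the bound [i]
   is read outside the quantifier and variable 0 of [p] is the bound one. *)
Inductive bformula : Type :=
| BMem of nat & nat
| BEq of nat & nat
| BNot of bformula
| BAnd of bformula & bformula
| BOr of bformula & bformula
| BImp of bformula & bformula
| BAll of nat & bformula
| BEx of nat & bformula.

Definition push (U : Type) (a : U) (e : nat -> U) : nat -> U :=
  fun n => if n is k.+1 then e k else a.

Fixpoint sat (X : Type) (V : superstructure X) (e : nat -> V) (p : bformula) :
    Prop :=
  match p with
  | BMem i j => elem (e i) (e j)
  | BEq i j => e i = e j
  | BNot q => ~ sat e q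
  | BAnd q1 q2 => sat e q1 /\ sat e q2
  | BOr q1 q2 => sat e q1 \/ sat e q2
  | BImp q1 q2 => sat e q1 -> sat e q2
  | BAll i q => forall a, elem a (e i) -> sat (push a e) q
  | BEx i q => exists2 a, elem a (e i) & sat (push a e) q
  end.

(* A nonstandard extension * : V(X) -> V(Y), where Y = *X. *)
Record nsextension (X Y : Type) (V : superstructure X) (W : superstructure Y) :=
  NSExtension {
  star :> V -> W;
  star_base : star (setof (range atom)) = setof (range atom);
  transfer : forall (p : bformula) (e : nat -> V),
    sat e p <-> sat (star \o e) p }.

Definition internal (X Y : Type) (V : superstructure X) (W : superstructure Y)
    (st : nsextension V W) (a : W) : Prop :=
  exists b : V, elem a (st b).

(* Every family of at most card V(X) internal sets with the finite intersection
   property has nonempty intersection; such families are those indexed by V(X),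
   up to repetitions. *)
Definition polysaturated (X Y : Type) (V : superstructure X)
    (W : superstructure Y) (st : nsextension V W) : Prop :=
  forall F : V -> W,
    (forall i, internal st (F i)) ->
    (forall D : set V, finite_set D ->
      exists c, forall i, D i -> elem c (F i)) ->
    exists c, forall i, elem c (F i).

(** * Smooth functions, jets and differential operators on R^m *)

Definition partial (R : realType) (n : nat) (i : 'I_n) (f : 'rV[R]_n -> R) :
    'rV[R]_n -> R :=
  fun x => 'D_(delta_mx 0 i) f x.

Definition partials (R : realType) (n : nat) (s : seq 'I_n)
    (f : 'rV[R]_n -> R) : 'rV[R]_n -> R :=
  foldr (@partial R n) f s.

Definition smooth (R : realType) (n : nat) (f : 'rV[R]_n -> R) : Prop :=
  forall s : seq 'I_n,
    continuous (partials s f) /\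
    forall (i : 'I_n) (x : 'rV[R]_n), derivable (partials s f) x (delta_mx 0 i).

Definition Cinf (R : realType) (m : nat) : Type :=
  {f : 'rV[R]_m -> R | smooth f}.

Definition Cinf_fun (R : realType) (m : nat) (f : Cinf R m) : 'rV[R]_m -> R :=
  sval f.
Coercion Cinf_fun : Cinf >-> Funclass.

(* The multi-indices alpha in N^m with |alpha| <= r; the components are at most
   r, which makes this a finType. *)
Definition mindex (m r : nat) : finType :=
  {a : {ffun 'I_m -> 'I_r.+1} | (\sum_(i < m) a i <= r)%N}.

(* The operator d^alpha = d_1^(alpha_1) ... d_m^(alpha_m). *)
Definition mderiv (R : realType) (m r : nat) (a : mindex m r)
    (f : 'rV[R]_m -> R) : 'rV[R]_m -> R :=
  partials (flatten [seq nseq (val a i) i | i <- enum 'I_m]) f.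

Definition jet_class (R : realType) (m r : nat) (x : 'rV[R]_m) (f : Cinf R m) :
    set (Cinf R m) :=
  [set h | forall a : mindex m r, mderiv a h x = mderiv a f x].

(* The total space of the bundle of r-jets: the pairs (x, class of f for
   r-th order contact at x). *)
Definition jet (R : realType) (m r : nat) : Type :=
  {p : 'rV[R]_m * set (Cinf R m) | exists f, p.2 = jet_class r p.1 f}.

Definition jet_of (R : realType) (m r : nat) (x : 'rV[R]_m) (f : Cinf R m) :
    jet R m r :=
  exist _ (x, jet_class r x f) (ex_intro _ f erefl).

Definition jet_base (R : realType) (m r : nat) (p : jet R m r) : 'rV[R]_m :=
  (sval p).1.

Definition jet_coord (R : realType) (m r : nat) (a : mindex m r)
    (p : jet R m r) : R :=
  mderiv a (projT1 (cid (svalP p))) (jet_base p).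

Lemma jet_coordE (R : realType) (m r : nat) (a : mindex m r) (x : 'rV[R]_m)
    (f : Cinf R m) : jet_coord a (jet_of r x f) = mderiv a f x.
Proof.
rewrite /jet_coord /jet_base /=; case: cid => h /= fh.
by have /(_ a) : jet_class r x f h by rewrite fh.
Qed.

Definition jet_coords (R : realType) (m r : nat) (p : jet R m r) :
    'rV[R]_(m + #|mindex m r|) :=
  row_mx (jet_base p) (\row_k jet_coord (enum_val k) p).

(* Smoothness in the global coordinates (x_i, y_alpha). *)
Definition jet_smooth (R : realType) (m r : nat) (L : jet R m r -> R) : Prop :=
  exists2 F : 'rV[R]_(m + #|mindex m r|) -> R,
    smooth F & forall p, L p = F (jet_coords p).

Definition jetCinf (R : realType) (m r : nat) : Type :=
  {L : jet R m r -> R | jet_smooth L}.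

Record LPDO (R : realType) (m r : nat) := MkLPDO {
  lpdo_op :> Cinf R m -> 'rV[R]_m -> R;
  coef : mindex m r -> Cinf R m;
  lpdo_opE : forall h x,
    lpdo_op h x = \sum_(a : mindex m r) coef a x * mderiv a h x }.

Definition total_symbol (R : realType) (m r : nat) (P : LPDO R m r)
    (p : jet R m r) : R :=
  \sum_(a : mindex m r) coef P a (jet_base p) * jet_coord a p.

Lemma total_symbolE (R : realType) (m r : nat) (P : LPDO R m r)
    (f : Cinf R m) (x : 'rV[R]_m) : P f x = total_symbol P (jet_of r x f).
Proof. by rewrite lpdo_opE; apply: eq_bigr => a _; rewrite jet_coordE. Qed.

(** * These objects as elements of a superstructure over a set containing R *)

Definition kpair (X : Type) (V : superstructure X) (a b : V) : V :=
  setof [set setof [set a]; setof [set a; b]].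

Definition graph (X : Type) (V : superstructure X) (A B : Type) (cA : A -> V)
    (cB : B -> V) (f : A -> B) : V :=
  setof (range (fun a => kpair (cA a) (cB (f a)))).

Definition codeR (X : Type) (V : superstructure X) (R : realType)
    (inR : R -> X) (t : R) : V :=
  atom (inR t).

(* An m-tuple of reals is a function on {1, ..., m}. *)
Definition code_vec (X : Type) (V : superstructure X) (R : realType)
    (inR : R -> X) (m : nat) (x : 'rV[R]_m) : V :=
  graph (fun i : 'I_m => codeR V inR i.+1%:R) (codeR V inR) (x 0).

Definition code_Cinf (X : Type) (V : superstructure X) (R : realType)
    (inR : R -> X) (m : nat) (f : Cinf R m) : V :=
  graph (code_vec V inR (m:=m)) (codeR V inR) f.

Definition code_jet (X : Type) (V : superstructure X) (R : realType)
    (inR : R -> X) (m r : nat) (p : jet R m r) : V :=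
  kpair (code_vec V inR (sval p).1)
       (setof (code_Cinf V inR (m:=m) @` (sval p).2)).

Definition code_jetfun (X : Type) (V : superstructure X) (R : realType)
    (inR : R -> X) (m r : nat) (L : jet R m r -> R) : V :=
  graph (code_jet V inR (m:=m) (r:=r)) (codeR V inR) L.

Definition CinfV (X : Type) (V : superstructure X) (R : realType)
    (inR : R -> X) (m : nat) : V :=
  setof (range (code_Cinf V inR (m:=m))).

Definition jetV (X : Type) (V : superstructure X) (R : realType)
    (inR : R -> X) (m r : nat) : V :=
  setof (range (code_jet V inR (m:=m) (r:=r))).

Definition jetCinfV (X : Type) (V : superstructure X) (R : realType)
    (inR : R -> X) (m r : nat) : V :=
  setof (range (fun L : jetCinf R m r => code_jetfun V inR (sval L))).

Definition jet_projV (X : Type) (V : superstructure X) (R : realType)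
    (inR : R -> X) (m r : nat) : V :=
  graph (code_jet V inR (m:=m) (r:=r)) (code_vec V inR (m:=m))
        (@jet_base R m r).

(** * The pointwise covering property *)

(* L(p) = g( *x) is expressed by a common value c of the internal functions L
   at p and g at *x, functions being identified with their graphs. *)
Definition sigmaPCP (X Y : Type) (V : superstructure X) (W : superstructure Y)
    (st : nsextension V W) (R : realType) (inR : R -> X) (m r : nat)
    (L g : W) : Prop :=
  [/\ elem L (st (jetCinfV V inR m r)),
      elem g (st (CinfV V inR m)) &
      forall x : 'rV[R]_m, exists p : W,
        [/\ elem p (st (jetV V inR m r)),
            elem (kpair p (st (code_vec V inR x))) (st (jet_projV V inR m r)) &
            exists2 c : W, elem (kpair p c) L &
                           elem (kpair (st (code_vec V inR x)) c) g]].

(* Main.v *)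
(* The coordinates y_alpha on the fibre of the jet bundle over x take arbitrary
   values, already on the jets of the monomials (y - x)^alpha.  As some
   f_alpha(x) is nonzero, lambda_P is therefore onto R on this fibre.  For a
   fixed standard x, "every smooth g takes at x a value of lambda_P on the fibre
   over x" is then a bounded sentence that holds in V(X), and its transfer is
   the claim. *)

Require Import Defs.
From mathcomp Require Import all_boot all_order all_algebra.
From mathcomp Require Import all_classical all_reals all_analysis.

Import Order.TTheory GRing.Theory Num.Theory.
Import numFieldNormedType.Exports.
Local Open Scope classical_set_scope.
Local Open Scope ring_scope.

Set Implicit Arguments.
Unset Strict Implicit.

(** * Sets and pairs in a superstructure *)

Lemma level_le {X : Type} {V : superstructure X} (n k : nat) (a : V) :
  (n <= k)%N -> level (@elem X V) atom n a -> level (@elem X V) atom k a.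
Proof.
move=> /subnK <-; elim: (k - n)%N => // j IHj na.
by rewrite addSn; left; apply: IHj.
Qed.

Lemma level_setof {X : Type} {V : superstructure X} (n : nat) (A : set V) :
  A `<=` level (@elem X V) atom n -> level (@elem X V) atom n.+1 (setof A).
Proof.
move=> An; right; split; first exact: setof_set An.
by move=> c /(elem_setof An)/An.
Qed.

Lemma level_pair {X : Type} {V : superstructure X} (a b : V) :
  exists n, [set a; b] `<=` level (@elem X V) atom n.
Proof.
have [n an] := level_cover a; have [k bk] := level_cover b.
exists (maxn n k) => c [] ->.
- by apply: level_le an; rewrite leq_maxl.
- by apply: level_le bk; rewrite leq_maxr.
Qed.

Lemma elem_set2 {X : Type} {V : superstructure X} (a b c : V) :
  elem c (setof [set a; b]) <-> c = a \/ c = b.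
Proof. by have [n abn] := level_pair a b; exact: (elem_setof abn). Qed.

Lemma elem_set1 {X : Type} {V : superstructure X} (a c : V) :
  elem c (setof [set a]) <-> c = a.
Proof.
have [n an] := level_cover a.
by apply: (@elem_setof _ _ n) => _ ->.
Qed.

Lemma setof2_nonatom {X : Type} {V : superstructure X} (a b : V) :
  ~ range atom (setof [set a; b]).
Proof. by have [n abn] := level_pair a b; exact: (setof_set abn). Qed.

Lemma setof1_nonatom {X : Type} {V : superstructure X} (a : V) :
  ~ range atom (setof [set a]).
Proof.
have [n an] := level_cover a.
by apply: (@setof_set _ _ n) => _ ->.
Qed.

(** Urelements have no members, so exhibiting one member is enough to make extensionality
    applicable. *)
Lemma elem_nonatom {X : Type} {V : superstructure X} (a b : V) :
  elem a b -> ~ range atom b.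
Proof. by move=> ab [x _ xb]; apply: (@elem_atom _ V a x); rewrite xb. Qed.

Lemma setof1_eq {X : Type} {V : superstructure X} (a s : V) :
  elem a s -> (forall c, elem c s -> c = a) -> s = setof [set a].
Proof.
move=> sa sE; apply: elem_ext; [exact: elem_nonatom sa|exact: setof1_nonatom|].
by move=> c; rewrite elem_set1; split=> [/sE|->].
Qed.

Lemma setof2_eq {X : Type} {V : superstructure X} (a b s : V) :
  elem a s -> elem b s -> (forall c, elem c s -> c = a \/ c = b) ->
  s = setof [set a; b].
Proof.
move=> sa sb sE; apply: elem_ext; [exact: elem_nonatom sa|exact: setof2_nonatom|].
by move=> c; rewrite elem_set2; split=> [/sE|[] ->].
Qed.

(** Kuratowski's pair q = {s, t} with s = {a} and t = {a, b}. Both s and t are members of q, so q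
    itself bounds their quantifiers. Inside, t is 0 and s is 1; each [BAll] shifts them once
    more. *)
Definition is_pair (q a b : nat) : bformula :=
  BEx q (BEx q.+1
    (BAnd (BAll q.+2 (BOr (BEq 0 2) (BEq 0 1)))
    (BAnd (BAnd (BMem a.+2 1) (BAll 1 (BEq 0 a.+3)))
          (BAnd (BMem a.+2 0) (BAnd (BMem b.+2 0)
            (BAll 0 (BOr (BEq 0 a.+3) (BEq 0 b.+3)))))))).

(** Holds in every superstructure, so one formula is read as a statement on pairs in [V] before
    transfer and in [W] after it. *)
Lemma sat_is_pair {X : Type} {V : superstructure X} (e : nat -> V)
    (q a b : nat) :
  sat e (is_pair q a b) <-> e q = kpair (e a) (e b).
Proof.
split=> /= [[s sq [t tq [qE [[sa sE] [ta [tb tE]]]]]]|qE].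
  rewrite /kpair -(setof1_eq sa sE) -(setof2_eq ta tb tE).
  exact: setof2_eq.
exists (setof [set e a]); first by rewrite qE; apply/elem_set2; left.
exists (setof [set e a; e b]); first by rewrite qE; apply/elem_set2; right.
split; first by move=> c; rewrite qE => /elem_set2.
split; first by split=> [|c]; rewrite elem_set1.
split; first by apply/elem_set2; left.
split; first by apply/elem_set2; right.
by move=> c /elem_set2.
Qed.

Definition has_pair (f a b : nat) : bformula :=
  BEx f (is_pair 0 a.+1 b.+1).

Lemma sat_has_pair {X : Type} {V : superstructure X} (e : nat -> V)
    (f a b : nat) :
  sat e (has_pair f a b) <-> elem (kpair (e a) (e b)) (e f).
Proof.
split=> [[q qf /sat_is_pair /= <- //]|abf].
by exists (kpair (e a) (e b)) => //; apply/sat_is_pair.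
Qed.

(** * Levels of the codes *)

(* [setof] behaves as the set of its elements only below some level, so every
   coding function must be bounded. *)
Definition bounded_code {X : Type} (V : superstructure X) (A : Type)
    (c : A -> V) : Prop :=
  exists n, forall a, level (@elem X V) atom n (c a).

Lemma elem_range {X : Type} {V : superstructure X} (A : Type) (c : A -> V) :
  bounded_code c -> forall b, elem b (setof (range c)) <-> range c b.
Proof. by move=> [n cn]; apply: (@elem_setof _ _ n) => _ [a _ <-]. Qed.

Lemma bounded_kpair {X : Type} {V : superstructure X} (A : Type)
    (c d : A -> V) :
  bounded_code c -> bounded_code d -> bounded_code (fun a => kpair (c a) (d a)).
Proof.
(* The singleton and the doubleton lie one level above the components, and the pair one level above
   these. *)
move=> [n cn] [k dk]; exists (maxn n k).+2 => a.
have ca : level (@elem X V) atom (maxn n k) (c a).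
  by apply: level_le (cn a); rewrite leq_maxl.
have da : level (@elem X V) atom (maxn n k) (d a).
  by apply: level_le (dk a); rewrite leq_maxr.
by apply: level_setof => _ [] ->; apply: level_setof => z; [move=> ->|case=> ->].
Qed.

Lemma bounded_setof {X : Type} {V : superstructure X} (A B : Type)
    (c : A -> V) (F : B -> set A) :
  bounded_code c -> bounded_code (fun b => setof (c @` F b)).
Proof.
by move=> [n cn]; exists n.+1 => b; apply: level_setof => _ [a _ <-].
Qed.

(** Bounding all pairs over [A * B] at once gives a level independent of [f], as needed to bound the
    graphs of a whole family of functions. *)
Lemma bounded_kpair_graph {X : Type} {V : superstructure X} (A B : Type)
    (cA : A -> V) (cB : B -> V) :
  bounded_code cA -> bounded_code cB ->
  exists n, forall (f : A -> B) a,
    level (@elem X V) atom n (kpair (cA a) (cB (f a))).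
Proof.
move=> [n An] [k Bk].
have [||l kl] := @bounded_kpair X V (A * B) (cA \o fst) (cB \o snd).
- by exists n => p; exact: An.
- by exists k => p; exact: Bk.
- by exists l => f a; exact: (kl (a, f a)).
Qed.

Lemma bounded_graph {X : Type} {V : superstructure X} (A B I : Type)
    (cA : A -> V) (cB : B -> V) (f : I -> A -> B) :
  bounded_code cA -> bounded_code cB ->
  bounded_code (fun i => graph cA cB (f i)).
Proof.
move=> bA bB; have [n kn] := bounded_kpair_graph bA bB.
by exists n.+1 => i; apply: level_setof => _ [a _ <-].
Qed.

Lemma elem_graph {X : Type} {V : superstructure X} (A B : Type)
    (cA : A -> V) (cB : B -> V) (f : A -> B) (a : A) :
  bounded_code cA -> bounded_code cB ->
  elem (kpair (cA a) (cB (f a))) (graph cA cB f).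
Proof.
move=> bA bB; have [n kn] := bounded_kpair_graph bA bB.
by apply/elem_range; [exists n => b; exact: kn|exists a].
Qed.

Section Codes.
Variables (R : realType) (X : Type) (V : superstructure X) (inR : R -> X).

Lemma bounded_codeR : bounded_code (codeR V inR).
Proof. by exists 0%N => t; exists (inR t). Qed.

Lemma bounded_code_vec (m : nat) : bounded_code (code_vec V inR (m:=m)).
Proof.
apply: bounded_graph; last exact: bounded_codeR.
by have [n cn] := bounded_codeR; exists n.
Qed.

Lemma bounded_code_Cinf (m : nat) : bounded_code (code_Cinf V inR (m:=m)).
Proof. by apply: bounded_graph; [exact: bounded_code_vec|exact: bounded_codeR]. Qed.

Lemma bounded_code_jet (m r : nat) :
  bounded_code (code_jet V inR (m:=m) (r:=r)).
Proof.
apply: bounded_kpair; last exact: bounded_setof (bounded_code_Cinf m).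
by have [n cn] := bounded_code_vec m; exists n.
Qed.

Lemma bounded_code_jetfun (m r : nat) :
  bounded_code (code_jetfun V inR (m:=m) (r:=r)).
Proof. by apply: bounded_graph; [exact: bounded_code_jet|exact: bounded_codeR]. Qed.

End Codes.

(** * Smooth functions *)

Section Smooth.
Context {R : realType}.

Lemma partials_rcons n (s : seq 'I_n) i (f : 'rV[R]_n -> R) :
  partials (rcons s i) f = partials s (partial i f).
Proof. by rewrite /partials foldr_rcons. Qed.

(* Smoothness as a greatest fixed point. *)
Lemma smooth_coind n (S : ('rV[R]_n -> R) -> Prop) :
  (forall f, S f -> continuous f /\
    forall i, (forall x, derivable f x (delta_mx 0 i)) /\ S (partial i f)) ->
  forall f, S f -> smooth f.
Proof.
move=> SP f Sf s; have : S (partials s f).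
  (* The last index of [s] is the innermost derivative, the first to act on [f]; hence the induction
     from the right. *)
  by elim/last_ind: s f Sf => // s i IHs f /SP[_ /(_ i)[_ /IHs]]; rewrite partials_rcons.
by move=> /SP[fc fd]; split=> // i x; have [] := fd i.
Qed.

Lemma smooth_continuous n (f : 'rV[R]_n -> R) : smooth f -> continuous f.
Proof. by move=> /(_ [::])[]. Qed.

Lemma smooth_derivable n (f : 'rV[R]_n -> R) i x :
  smooth f -> derivable f x (delta_mx 0 i).
Proof. by move=> /(_ [::])[]. Qed.

Lemma smooth_partial n (f : 'rV[R]_n -> R) i : smooth f -> smooth (partial i f).
Proof. by move=> fs s; rewrite -partials_rcons; exact: fs. Qed.

(** By Leibniz' rule the derivative of a product is a sum of products. The closure under both
    operations is therefore stable under [partial] and serves as the invariant for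
    [smooth_coind]. *)
Inductive smooth_alg n : ('rV[R]_n -> R) -> Prop :=
| smooth_alg_base f : smooth f -> smooth_alg f
| smooth_alg_add f g : smooth_alg f -> smooth_alg g -> smooth_alg (f + g)
| smooth_alg_mul f g : smooth_alg f -> smooth_alg g -> smooth_alg (f * g).

Lemma smooth_algP n (f : 'rV[R]_n -> R) : smooth_alg f -> smooth f.
Proof.
apply: smooth_coind => {}f; elim=> {f} [f fs|f g fa [fc fd] ga [gc gd]|
    f g fa [fc fd] ga [gc gd]].
- split=> [|i]; first exact: smooth_continuous.
  split=> [x|]; first exact: smooth_derivable.
  by apply: smooth_alg_base; exact: smooth_partial.
- split=> [x|i]; first by apply: continuousD; [exact: fc|exact: gc].
  have [[fi fS] [gi gS]] := (fd i, gd i).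
  split=> [x|]; first exact: derivableD.
  suff -> : partial i (f + g) = partial i f + partial i g.
    exact: smooth_alg_add.
  by apply/funext => x; rewrite /partial deriveD.
- split=> [x|i]; first by apply: continuousM; [exact: fc|exact: gc].
  have [[fi fS] [gi gS]] := (fd i, gd i).
  split=> [x|]; first exact: derivableM.
  suff -> : partial i (f * g) = f * partial i g + g * partial i f.
    by apply: smooth_alg_add; apply: smooth_alg_mul.
  by apply/funext => x; rewrite /partial deriveM.
Qed.

Lemma smoothD n (f g : 'rV[R]_n -> R) : smooth f -> smooth g -> smooth (f + g).
Proof.
by move=> fs gs; apply/smooth_algP/smooth_alg_add; exact: smooth_alg_base.
Qed.

Lemma smoothM n (f g : 'rV[R]_n -> R) : smooth f -> smooth g -> smooth (f * g).
Proof.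
by move=> fs gs; apply/smooth_algP/smooth_alg_mul; exact: smooth_alg_base.
Qed.

Lemma smooth_cst n (c : R) : smooth (cst c : 'rV[R]_n -> R).
Proof.
apply: (@smooth_coind _ (fun f => exists c, f = cst c)); last by exists c.
move=> _ [d ->]; split=> [x|i]; first exact: cst_continuous.
split=> [x|]; first exact: derivable_cst.
by exists 0; apply/funext => x; rewrite /partial derive_cst.
Qed.

Lemma smooth_sum n (I : Type) (s : seq I) (F : I -> 'rV[R]_n -> R) :
  (forall i, smooth (F i)) -> smooth (fun x => \sum_(i <- s) F i x).
Proof.
move=> Fs; elim: s => [|i s IHs].
  by under eq_fun do rewrite big_nil; exact: smooth_cst.
by under eq_fun do rewrite big_cons; exact: smoothD.
Qed.

Lemma smooth_prod n (I : Type) (s : seq I) (F : I -> 'rV[R]_n -> R) :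
  (forall i, smooth (F i)) -> smooth (fun x => \prod_(i <- s) F i x).
Proof.
move=> Fs; elim: s => [|i s IHs].
  by under eq_fun do rewrite big_nil; exact: smooth_cst.
by under eq_fun do rewrite big_cons; exact: smoothM.
Qed.

Lemma smoothX n (f : 'rV[R]_n -> R) k : smooth f -> smooth (fun x => f x ^+ k).
Proof.
move=> fs; elim: k => [|k IHk]; first exact: smooth_cst.
by under eq_fun do rewrite exprS; exact: smoothM.
Qed.

(** Both difference quotients are the same function of h. This brings directional derivatives within
    reach of the one-variable rules. *)
Lemma is_derive_line n (f : 'rV[R]_n -> R) y v df :
  is_derive (0 : R) 1 (fun t : R => f (t *: v + y)) df -> is_derive y v f df.
Proof.
have E : (fun h => h^-1 *: ((f \o shift y) (h *: v) - f y)) =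
    (fun h : R => h^-1 *: (((fun t : R => f (t *: v + y)) \o shift (0 : R)) (h *: (1 : R))
      - f ((0 : R) *: v + y))).
  by apply/funext => h /=; rewrite scale0r add0r addr0 /GRing.scale /= mulr1.
by move=> [fd <-]; split; rewrite /derivable /derive E.
Qed.

Lemma is_derive_coord n (i : 'I_n) (y v : 'rV[R]_n) :
  is_derive y v (fun x : 'rV[R]_n => x 0 i) (v 0 i).
Proof.
apply: is_derive_line.
have -> : (fun t : R => (t *: v + y) 0 i) = v 0 i \*: id + cst (y 0 i).
  by apply/funext => t; rewrite !mxE mulrC.
by apply: is_derive_eq; rewrite addr0 /GRing.scale /= mulr1.
Qed.

Lemma smooth_coord n (i : 'I_n) : smooth (fun x : 'rV[R]_n => x 0 i).
Proof.
(* The partial derivatives of a coordinate are constants, which are already known to be smooth. *)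
apply: (@smooth_coind _ (fun f => smooth f \/ f = fun x => x 0 i)); last by right.
move=> f [fs|->].
  split=> [|j]; first exact: smooth_continuous.
  by split=> [x|]; [exact: smooth_derivable|left; exact: smooth_partial].
split=> [|j]; first exact: coord_continuous.
split=> [x|]; first by have [] := is_derive_coord i x (delta_mx 0 j).
left; suff -> : partial j (fun x : 'rV[R]_n => x 0 i) = cst ((delta_mx 0 j : 'rV[R]_n) 0 i).
  exact: smooth_cst.
by apply/funext => x; have [] := is_derive_coord i x (delta_mx 0 j).
Qed.

Lemma derive_lsubmx n k (f : 'rV[R]_n -> R) (z v : 'rV[R]_(n + k)) df :
  is_derive (lsubmx z) (lsubmx v) f df ->
  is_derive z v (fun z => f (lsubmx z)) df.
Proof.
have E : (fun h => h^-1 *: (((fun z => f (lsubmx z)) \o shift z) (h *: v)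
                            - f (lsubmx z))) =
    (fun h : R => h^-1 *: ((f \o shift (lsubmx z)) (h *: lsubmx v)
                            - f (lsubmx z))).
  apply/funext => h /=; congr (_ *: (f _ - _)).
  by apply/rowP => i; rewrite !mxE.
by move=> [fd <-]; split; rewrite /derivable /derive E.
Qed.

(** Pullbacks along the projection are stable under [partial]: a base direction differentiates [f],
    a fibre direction gives 0. This handles the coefficients, which depend on the base point
    only. *)
Lemma smooth_lsubmx n k (f : 'rV[R]_n -> R) :
  smooth f -> smooth (fun z : 'rV[R]_(n + k) => f (lsubmx z)).
Proof.
move=> fs; pose S (F : 'rV[R]_(n + k) -> R) :=
  exists2 f : 'rV[R]_n -> R, smooth f & F = fun z => f (lsubmx z).
apply: (@smooth_coind _ S); last by exists f.
move=> _ [{}f {}fs ->]; split=> [z|i].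
  apply: (@continuous_comp _ _ _ lsubmx f); first exact: continuous_lsubmx.
  exact: smooth_continuous.
have fd z : is_derive z (delta_mx 0 i) (fun z : 'rV[R]_(n + k) => f (lsubmx z))
    ('D_(lsubmx (delta_mx 0 i)) f (lsubmx z)).
  apply/derive_lsubmx/derivableP.
  case: (split_ordP i) => j ->; last first.
    suff -> : lsubmx (delta_mx 0 (rshift n j) : 'rV[R]_(n + k)) = 0.
      exact: derivable0.
    by apply/rowP => l; rewrite !mxE eq_lrshift andbF.
  suff -> : lsubmx (delta_mx 0 (lshift k j) : 'rV[R]_(n + k)) = delta_mx 0 j.
    exact: smooth_derivable.
  by apply/rowP => l; rewrite !mxE eq_lshift.
split=> [z|]; first by have [] := fd z.
have -> : partial i (fun z : 'rV[R]_(n + k) => f (lsubmx z)) =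
    fun z => 'D_(lsubmx (delta_mx 0 i)) f (lsubmx z).
  by apply/funext => z; have [] := fd z.
exists (fun x => 'D_(lsubmx (delta_mx 0 i)) f x) => //.
case: (split_ordP i) => j ->.
  suff -> : lsubmx (delta_mx 0 (lshift k j) : 'rV[R]_(n + k)) = delta_mx 0 j.
    exact: smooth_partial.
  by apply/rowP => l; rewrite !mxE eq_lshift.
suff -> : lsubmx (delta_mx 0 (rshift n j) : 'rV[R]_(n + k)) = 0.
  by under eq_fun do rewrite derive0; exact: smooth_cst.
by apply/rowP => l; rewrite !mxE eq_lrshift andbF.
Qed.

(** * Derivatives of the monomials centred at x *)

Definition mono n (x : 'rV[R]_n) (e : 'I_n -> nat) (y : 'rV[R]_n) : R :=
  \prod_i (y 0 i - x 0 i) ^+ e i.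

Lemma smooth_mono n (x : 'rV[R]_n) t e : smooth (fun y => t * mono x e y).
Proof.
apply: smoothM; first exact: smooth_cst.
apply: smooth_prod => i; apply: smoothX.
by apply: smoothD; [exact: smooth_coord|exact: smooth_cst].
Qed.

(** When [e i] is 0, the truncated exponent is harmless because the factor [(e i)%:R] vanishes. *)
Lemma is_derive_mono n (x : 'rV[R]_n) t e i y :
  is_derive y (delta_mx 0 i) (fun y => t * mono x e y)
    (t * (e i)%:R * mono x (fun j => (e j - (j == i))%N) y).
Proof.
apply: is_derive_line.
(* Only the i-th factor varies along the line; [K] collects the constant ones. *)
pose K := t * \prod_(j | j != i) (y 0 j - x 0 j) ^+ e j.
have -> : (fun u : R => t * mono x e (u *: delta_mx 0 i + y)) =
    K \*: (id + cst (y 0 i - x 0 i)) ^+ e i.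
  apply/funext => u; rewrite /mono (bigD1 i) //= mulrCA mulrC fctE; congr (_ * _ ^+ _).
    congr (_ * _).
    by apply: eq_bigr => j /negPf ji; rewrite !mxE eqxx ji mulr0 add0r.
  by rewrite !mxE !eqxx mulr1 addrA.
apply: is_derive_eq; rewrite /mono (bigD1 i) //= eqxx subn1 addr0 /= fctE add0r.
rewrite /GRing.scale /= mulr1 -!mulrA; congr (_ * _); rewrite mulrC -mulrA; congr (_ * (_ * _)).
by apply: eq_bigr => j /negPf ->; rewrite subn0.
Qed.

(** Each occurrence of i in [s] contributes one more factor to a falling factorial. That factorial
    is 0 as soon as i occurs more than [e i] times, which again covers truncation. *)
Lemma partials_mono n (x : 'rV[R]_n) (t : R) s e :
  partials s (fun y => t * mono x e y) =
  (fun y => t * (\prod_i (e i) ^_ (count_mem i s))%:R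
            * mono x (fun i => (e i - count_mem i s)%N) y).
Proof.
elim: s => [|i s IHs] /=; apply/funext => y.
  rewrite big1 ?mulr1; last by move=> j _; rewrite ffactn0.
  by congr (_ * _); apply: eq_bigr => j _; rewrite subn0.
rewrite IHs /partial (derive_val (is_derive := is_derive_mono _ _ _ _ _)).
rewrite -(mulrA t) -natrM; congr (_ * _%:R * _).
  rewrite (bigD1 i) //= [RHS](bigD1 i) //= eqxx ffactnSr mulnAC; congr (_ * _)%N.
  by apply: eq_bigr => j /negPf ji; rewrite eq_sym ji.
by apply: eq_bigr => j _; rewrite -subnDA addnC (eq_sym j).
Qed.

(** If b differs from a at i, then either b_i < a_i and a positive power of 0 remains at the centre,
    or b_i > a_i and the falling factorial vanishes. *)
Lemma mderiv_mono m r (x : 'rV[R]_m) t (a b : mindex m r) :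
  mderiv b (fun y => t * mono x (fun i => val a i) y) x =
  if b == a then t * (\prod_i (val a i)`!)%:R else 0.
Proof.
have countE i : count_mem i (flatten [seq nseq (val b j) j | j <- enum 'I_m]) = val b i.
  rewrite count_flatten -map_comp sumnE big_map big_enum /= (bigD1 i) //= big1.
    by rewrite count_nseq /= eqxx mul1n addn0.
  by move=> j /negPf ji; rewrite count_nseq /= ji.
rewrite /mderiv partials_mono; under eq_bigr do rewrite countE.
rewrite /mono; under [X in _ * X]eq_bigr do rewrite countE subrr.
have [->|ba] := eqVneq.
  rewrite [X in _ * X]big1 ?mulr1 => [|i _]; last by rewrite subnn.
  by congr (_ * _%:R); apply: eq_bigr => i _; rewrite ffactnn.
have [i abi] : exists i, val b i != val a i :> nat.
  apply/existsP; apply: contraNT ba => /existsPn ba.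
  by apply/eqP/val_inj/ffunP => i; apply/val_inj/eqP; move: (ba i); rewrite negbK.
case: (ltngtP (val b i) (val a i)) abi => // lt_i _.
  by rewrite [X in _ * X](bigD1 i) //= expr0n subn_eq0 leqNgt lt_i mul0r mulr0.
by rewrite (bigD1 i) //= ffact_small // mul0n mulr0 mul0r.
Qed.

(** * The total symbol: smoothness and surjectivity on fibres *)

Lemma jet_smooth_total_symbol m r (P : LPDO R m r) : jet_smooth (total_symbol P).
Proof.
(* In [jet_coords] the base point comes first, and y_alpha sits at the rank of alpha after it. *)
exists (fun z => \sum_a coef P a (lsubmx z) * z 0 (rshift m (enum_rank a))).
  apply: smooth_sum => a; apply: smoothM; last exact: smooth_coord.
  by apply: smooth_lsubmx; exact: svalP.
move=> p; apply: eq_bigr => a _.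
by rewrite row_mxKl row_mxEr mxE enum_rankK.
Qed.

Lemma total_symbol_surj m r (P : LPDO R m r) (x : 'rV[R]_m) (c : R) :
  \sum_a `|coef P a x| != 0 ->
  exists2 p, jet_base p = x & total_symbol P p = c.
Proof.
move=> Pnz; have [a Pa] : exists a, coef P a x != 0.
  apply/existsP; apply: contraNT Pnz => /existsPn P0.
  by rewrite big1 // => a _; apply/eqP; rewrite normr_eq0; apply/negPn.
(* On the jet at x of t(y - x)^a only the coordinate y_a can be nonzero, with value t a!; this t
   makes the single remaining term f_a(x) t a! equal to c. *)
pose t := c / (coef P a x * (\prod_i (val a i)`!)%:R).
pose f : Cinf R m := exist _ _ (smooth_mono x t (fun i => val a i)).
exists (jet_of r x f) => //; rewrite -total_symbolE lpdo_opE.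
rewrite (bigD1 a) //= big1 => [|b /negPf ba]; last first.
  by rewrite mderiv_mono ba mulr0.
rewrite mderiv_mono eqxx addr0 /t mulrCA mulfVK // mulf_neq0 //.
by rewrite pnatr_eq0 -lt0n prodn_gt0 // => i; rewrite fact_gt0.
Qed.

End Smooth.

(** * The transfer argument *)

Unset Implicit Arguments.

Theorem lemma6p1 (R : realType) (X Y : Type)
    (V : superstructure X) (W : superstructure Y)
    (inR : R -> X) (inR_inj : injective inR)
    (st : nsextension V W) (st_polysat : polysaturated st)
    (m r : nat) (m_ge1 : (1 <= m)%N) (P : LPDO R m r)
    (P_nz : forall x : 'rV[R]_m,
      \sum_(a : mindex m r) `|coef P a x| != 0)
    (g : W) (g_smooth : elem g (st (CinfV V inR m))) :
  sigmaPCP st inR m r (st (code_jetfun V inR (total_symbol P))) g.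
Proof.
split=> // [|x].
  apply: (transfer st (BMem 0 1) (nth (jetCinfV V inR m r)
    [:: code_jetfun V inR (total_symbol P)])).1.
  apply/elem_range.
    by have [n Ln] := bounded_code_jetfun V inR m r; exists n => L; exact: Ln.
  by exists (exist _ _ (jet_smooth_total_symbol P)).
(* The default of [nth] is x, so index 5 denotes x, which becomes 8 under three quantifiers. As a
   parameter, x is sent by transfer to its own star. The set of reals is listed to bound the
   quantifier on c. *)
pose e : nat -> V := nth (code_vec V inR x)
  [:: CinfV V inR m; jetV V inR m r; jet_projV V inR m r;
      code_jetfun V inR (total_symbol P); setof (range (codeR V inR))].
(* Under the three quantifiers, 0, 1, 2 are c, p, g, and k.+3 is [e k]. *)
pose phi := BAll 0 (BEx 2 (BEx 6
  (BAnd (has_pair 5 1 8) (BAnd (has_pair 6 1 0) (has_pair 2 8 0))))).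
have : sat e phi.
  move=> _ /(elem_range (bounded_code_Cinf V inR m))[h _ <-].
  have [p px pc] := total_symbol_surj (h x) (P_nz x).
  exists (code_jet V inR p).
    by apply/(elem_range (bounded_code_jet V inR m r)); exists p.
  exists (codeR V inR (h x)).
    by apply/(elem_range (bounded_codeR V inR)); exists (h x).
  have bvec := bounded_code_vec V inR m; have breal := bounded_codeR V inR.
  have bjet := bounded_code_jet V inR m r.
  split; [|split]; apply/sat_has_pair.
  - by have := elem_graph (@jet_base R m r) p bjet bvec; rewrite px.
  - by have := elem_graph (total_symbol P) p bjet breal; rewrite pc.
  - exact: (elem_graph h x bvec breal).
(* After transfer the outer quantifier ranges over all internal smooth functions, so it applies to
   [g] even if [g] is not the star of a function. *)
move=> /(transfer st phi)/(_ g g_smooth)[p pJ [c cR]].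
move=> [/sat_has_pair px [/sat_has_pair pc /sat_has_pair xc]].
by exists p; split=> //; exists c.
Qed.
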